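(* Let $k$ be a field. Every finite simplicial complex $\Delta$ not equal to the boundary of a simplex is the Scarf complex of some squarefree monomial ideal (in a polynomial ring over $k$). If $\Delta$ is acyclic (over $k$), then $\Delta$ supports the minimal free resolution of that ideal.
   Context: Let $I$ be a monomial ideal with minimal monomial generators $m_1,\ldots,m_r$ in a polynomial ring $S$ over $k$. Label each subset $F\subseteq\{1,\ldots,r\}$ by the monomial $m_F=\operatorname{lcm}(m_i: i\in F)$. The Scarf complex of $I$ is the simplicial complex on $\{1,\ldots,r\}$ whose faces are those $F$ whose label is unique, i.e. $m_F\ne m_G$ for all $G\neq F$. ''$\Delta$ is the Scarf complex of $I$'' means that $\Delta$ is identified with it under a bijection between the vertices of $\Delta$ and the generators of $I$. A labeled simplicial complex $\Delta$ (a subcomplex of the full simplex on the generators, with labels $m_F$) supports the minimal resolution of $I$ if the $\mathbb{N}^n$-graded complex of free $S$-modules obtained by homogenizing the augmented oriented simplicial chain complex of $\Delta$ over $k$ with the labels (basis element $e_F$ in multidegree $m_F$, differential $e_F\mapsto\sum_{i\in F}\pm \frac{m_F}{m_{F\setminus i}}e_{F\setminus i}$) is a minimal free resolution of $S/I$. Acyclic means that all reduced homology with coefficients in $k$ vanishes. *)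

(* Defs.v *)
From HB Require Import structures.
From mathcomp Require Import all_boot all_order all_algebra.
From mathcomp Require Export mpoly.

Set Implicit Arguments.
Unset Strict Implicit.
Unset Printing Implicit Defensive.

Import GRing.Theory.
Local Open Scope ring_scope.

(* ** Simplicial complexes and reduced simplicial homology *)

Section Simplicial.
Variable V : finType.
Implicit Types (D : {set {set V}}) (F G : {set V}).

(* An abstract simplicial complex whose vertex set is exactly V. *)
Definition simplicial_complex D : Prop :=
  [/\ set0 \in D,
      forall v : V, [set v] \in D
    & forall F G, F \in D -> G \subset F -> G \in D].

(* For a simplicial complex D on V this forces W = [set: V] with at least two
   vertices. The complex [set set0] on an empty V is not counted as a
   boundary: it is the Scarf complex of the zero ideal. *)
Definition is_simplex_boundary D : Prop :=
  exists W : {set V}, D = [set F : {set V} | F \proper W].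

(* Faces are indexed by cardinality, i.e. by dimension + 1, so that degree 0
   is the augmentation term, spanned by the empty face. *)
Definition faces D (i : nat) : {set {set V}} := [set F in D | #|F| == i].

(* The oriented incidence number of F and G, for the orientation given by the
   enumeration order of V. The sum has at most one term. *)
Definition incidence (R : pzRingType) F G : R :=
  \sum_(v in F | F :\ v == G)
    (-1) ^+ #|[set w in F | (enum_rank w < enum_rank v)%N]|.

(* Matrices act on row vectors on the right: row a is the boundary of the
   a-th face of cardinality i.+1. *)
Definition boundary_mx (R : pzRingType) D (i : nat) :
    'M[R]_(#|faces D i.+1|, #|faces D i|) :=
  \matrix_(a, b) incidence R (enum_val a) (enum_val b).

(* The first clause is the vanishing of reduced homology in dimension -1,
   the second in dimension i, for every i. *)
Definition acyclic (k : fieldType) D : Prop :=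
  (1%:M <= boundary_mx k D 0)%MS
  /\ forall i, (kermx (boundary_mx k D i) <= boundary_mx k D i.+1)%MS.

End Simplicial.

(* ** Monomial ideals *)

(* Ideals are Prop-valued predicates, since membership need not be decidable
   a priori. *)
Definition ideal_gen (R : comNzRingType) (J : finType) (A : {set J})
    (g : J -> R) : R -> Prop :=
  fun p => exists c : J -> R, p = \sum_(j in A) c j * g j.

Section MonomialIdeals.
Variables (k : fieldType) (n : nat).
Local Notation S := {mpoly k[n]}.

Definition monomial_ideal_gen (J : finType) (A : {set J})
    (m : J -> 'X_{1..n}) : S -> Prop :=
  ideal_gen A (fun j => 'X_[m j] : S).

Definition squarefree (m : 'X_{1..n}) : Prop := forall i, (m i <= 1)%N.

Definition squarefree_monomial_ideal (I : S -> Prop) : Prop :=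
  exists (r : nat) (g : 'I_r -> 'X_{1..n}),
    (forall j, squarefree (g j))
    /\ (forall p, I p <-> monomial_ideal_gen [set: 'I_r] g p).

(* The family m generates I and no proper subfamily does; in particular m is
   injective, so J is in bijection with the set of generators. *)
Definition minimal_monomial_generators (J : finType) (I : S -> Prop)
    (m : J -> 'X_{1..n}) : Prop :=
  forall A : {set J},
    (forall p, I p <-> monomial_ideal_gen A m p) <-> A = [set: J].

Definition irrelevant_ideal : S -> Prop :=
  ideal_gen [set: 'I_n] (fun i => 'X_i : S).

End MonomialIdeals.

(* ** The Scarf complex *)

Section Scarf.
Variables (n : nat) (V : finType) (m : V -> 'X_{1..n}).

Definition label (F : {set V}) : 'X_{1..n} :=
  \big[@mlcm n/0%MM]_(v in F) m v.

Definition scarf_complex : {set {set V}} :=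
  [set F | [forall G : {set V}, (label G == label F) ==> (G == F)]].

End Scarf.

(* ** Multigraded free resolutions *)

Section Resolutions.
Variables (k : fieldType) (n : nat).
Local Notation S := {mpoly k[n]}.

(* A sequence ... -> F_1 -> F_0 -> S of maps of finite free modules with
   homogeneous bases; the elements of F_i are row vectors over S. *)
Record free_complex := FreeComplex {
  fc_rank : nat -> nat;
  fc_deg : forall i, 'I_(fc_rank i) -> 'X_{1..n};
  fc_dif : forall i, 'M[S]_(fc_rank i.+1, fc_rank i);
  fc_aug : 'cV[S]_(fc_rank 0)
}.

(* All maps are homogeneous of multidegree 0. *)
Definition multigraded (C : free_complex) : Prop :=
  (forall i a b e, e \in msupp (fc_dif C i a b) ->
     (e + fc_deg b)%MM = fc_deg a)
  /\ (forall b e, e \in msupp (fc_aug C b 0) -> e = fc_deg b).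

(* Exactness of ... -> F_1 -> F_0 -> S/I -> 0, where F_0 -> S/I is fc_aug
   followed by the projection. *)
Definition resolves_quotient (I : S -> Prop) (C : free_complex) : Prop :=
  [/\ forall p : S, exists u : 'rV_(fc_rank C 0),
        I (p - (u *m fc_aug C) 0 0),
      forall u : 'rV_(fc_rank C 0),
        I ((u *m fc_aug C) 0 0) <->
        exists w : 'rV_(fc_rank C 1), u = w *m fc_dif C 0
    & forall i (u : 'rV_(fc_rank C i.+1)),
        u *m fc_dif C i = 0 <->
        exists w : 'rV_(fc_rank C i.+2), u = w *m fc_dif C i.+1].

(* The image of each differential lies in (x_1, ..., x_n) times its target. *)
Definition minimal_complex (C : free_complex) : Prop :=
  forall i (u : 'rV_(fc_rank C i.+1)) b,
    irrelevant_ideal ((u *m fc_dif C i) 0 b).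

Definition minimal_free_resolution (I : S -> Prop) (C : free_complex) : Prop :=
  [/\ multigraded C, resolves_quotient I C & minimal_complex C].

Variables (V : finType) (m : V -> 'X_{1..n}) (D : {set {set V}}).

(* The augmented oriented chain complex of D homogenized by the labels. The
   quotient of labels is written with truncated subtraction, which is exact
   whenever the incidence number is nonzero, as then G is a subset of F. *)
Definition homogenized_complex : free_complex :=
  @FreeComplex (fun i => #|faces D i|)
    (fun i a => label m (enum_val a))
    (fun i => \matrix_(a, b)
       (incidence k (enum_val a) (enum_val b)
          *: 'X_[(label m (enum_val a) - label m (enum_val b))%MM]))
    (const_mx 1).

Definition supports_minimal_resolution (I : S -> Prop) : Prop :=
  minimal_free_resolution I homogenized_complex.

End Resolutions.

(* Main.v *)
(* Take one variable x_F for each face F of D and let m_v be the product of the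
   x_F with v not in F. The label of G is then the product of the x_F over the
   faces F not containing G. If G is a face, x_G does not divide its label, and
   only subsets of G have a label dividing it; all non-faces carry the full
   product as label, and there are at least two of them (or none) unless D is
   the boundary of a simplex. So the Scarf complex is D.
   For a degree b, the faces whose label divides b form D itself if every
   variable divides b, and otherwise the full simplex on the intersection of the
   faces F with b_F = 0. The first is acyclic by hypothesis, the second is a
   cone (or just the empty face), so by the Bayer-Sturmfels criterion the
   homogenized complex is exact. It is minimal since labels of faces differ. *)
Require Import Defs.
From HB Require Import structures.
From mathcomp Require Import all_boot all_order all_algebra ring zify.

Set Implicit Arguments.
Unset Strict Implicit.
Unset Printing Implicit Defensive.

Import GRing.Theory.
Local Open Scope ring_scope.

(** * Signed incidence numbers, chain boundaries and cones *)

Section Incidence.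
Variables (V : finType) (R : comNzRingType).
Implicit Types (F G H : {set V}) (f : {set V} -> R).

Definition face_sign F (v : V) : R :=
  (-1) ^+ #|[set w in F | (enum_rank w < enum_rank v)%N]|.

Lemma face_sign_sqr F v : face_sign F v * face_sign F v = 1.
Proof. by rewrite -expr2 sqrr_sign. Qed.

(** Removing the earlier of two vertices lowers the position of the later one by one and flips its
    sign. Removing the later one leaves the position of the earlier unchanged. *)
Lemma face_sign_anticomm F v w : v \in F -> w \in F -> v != w ->
  face_sign F v * face_sign (F :\ v) w = - (face_sign F w * face_sign (F :\ w) v).
Proof.
wlog lt_vw : v w / (enum_rank v < enum_rank w)%N => [hwlog vF wF neq_vw | vF wF neq_vw].
  have : enum_rank v != enum_rank w by rewrite (inj_eq enum_rank_inj).
  rewrite -val_eqE /= neq_ltn => /orP[lt|lt]; first exact: hwlog.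
  by rewrite (hwlog w v) ?opprK // eq_sym.
have -> : face_sign (F :\ w) v = face_sign F v.
  congr (_ ^+ #|pred_of_set _|); apply/setP => x; rewrite !inE.
  by case: (eqVneq x w) => //= ->; rewrite (ltnNge (enum_rank w)) ltnW // andbF.
have -> : face_sign F w = - face_sign (F :\ v) w.
  rewrite /face_sign (cardsD1 v) !inE vF lt_vw /= exprS mulN1r; congr (- (_ ^+ #|pred_of_set _|)).
  by apply/setP => x; rewrite !inE; case: (x == v).
by rewrite mulNr opprK mulrC.
Qed.

Lemma incidence_neq0 F G : incidence R F G != 0 ->
  exists2 v, v \in F & G = F :\ v.
Proof.
move=> nz; suff /exists_inP[v vF /eqP ->]: [exists v in F, G == F :\ v] by exists v.
apply: contraNT nz => /existsPn no.
rewrite /incidence big1 // => v /andP[vF /eqP FG].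
by move: (no v); rewrite vF FG eqxx.
Qed.

Lemma incidence_neq0_sub F G : incidence R F G != 0 -> G \subset F.
Proof. by case/incidence_neq0 => v _ ->; apply: subsetDl. Qed.

Lemma incidence_neq0_card F G : incidence R F G != 0 -> #|F| = #|G|.+1.
Proof. by case/incidence_neq0 => v vF ->; rewrite (cardsD1 v F) vF. Qed.

Lemma incidence_sum F f :
  \sum_G incidence R F G * f G = \sum_(v in F) face_sign F v * f (F :\ v).
Proof.
under eq_bigr => G _ do rewrite /incidence mulr_suml big_mkcondr.
rewrite exchange_big; apply: eq_bigr => v _ /=.
rewrite (bigD1 (F :\ v)) //= eqxx big1 ?addr0 // => G.
by rewrite eq_sym => /negPf ->.
Qed.

(** Chains are functions on all subsets of [V]. A chain of a complex is a function vanishing off its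
    faces, so sums need no index sets depending on the dimension. *)
Definition chain_boundary f G : R := \sum_F f F * incidence R F G.

Lemma chain_boundaryE f G :
  chain_boundary f G = \sum_(v in ~: G) f (v |: G) * face_sign (v |: G) v.
Proof.
rewrite /chain_boundary.
under eq_bigr => F _ do rewrite /incidence mulr_sumr big_mkcond.
rewrite exchange_big [RHS]big_mkcond; apply: eq_bigr => v _ /=.
rewrite (bigD1 (v |: G)) //= big1 ?addr0 => [|F].
  rewrite !inE eqxx /=; case: (boolP (v \in G)) => [vG|vG] /=; last by rewrite setU1K ?eqxx.
  by case: eqP => // /setP/(_ v); rewrite !inE eqxx vG.
apply: contraNeq; case: ifP => [/andP[vF /eqP <-] _|_]; last by rewrite eqxx.
by rewrite setD1K.
Qed.

(** Two vertices can be removed from [F] in two orders, and the two terms cancel by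
    [face_sign_anticomm]. *)
Lemma incidence_comp F H : \sum_G incidence R F G * incidence R G H = 0.
Proof.
pose r (v : V) := val (enum_rank v).
(* [t v w] is the term in which [v] is removed first and [w] second. [P] orders each pair, which
   separates the two orders of removal. *)
pose t v w := if (F :\ v) :\ w == H then face_sign F v * face_sign (F :\ v) w else 0.
pose P v w := [&& v \in F, w \in F & (r v < r w)%N].
have tC v w : P v w -> t w v = - t v w.
  case/and3P=> vF wF lt_vw; rewrite /t setDDl setUC -setDDl.
  case: eqP => _; last by rewrite oppr0.
  by rewrite (@face_sign_anticomm F v w) ?opprK //; apply: contraTneq lt_vw => ->; rewrite ltnn.
have -> : \sum_G incidence R F G * incidence R G H =
    \sum_v \sum_(w | P v w) t v w + \sum_v \sum_(w | P w v) t v w.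
  rewrite incidence_sum big_mkcond -big_split; apply: eq_bigr => v _ /=.
  case: (boolP (v \in F)) => vF; last first.
    by rewrite !big_pred0 ?addr0 // => w; rewrite /P (negPf vF) ?andbF.
  rewrite /incidence mulr_sumr big_mkcond.
  rewrite [X in _ = X + _]big_mkcond [X in _ = _ + X]big_mkcond -big_split /=.
  apply: eq_bigr => w _; rewrite /P vF /= !inE /t.
  case: (eqVneq w v) => [-> | neq_wv]; first by rewrite /= ltnn !andbF addr0.
  have: r w != r v by rewrite /r val_eqE (inj_eq enum_rank_inj).
  rewrite neq_ltn => /orP[] lt; rewrite lt ltnNge (ltnW lt) ?andbF ?andbT;
    by case: (w \in F); case: eqP; rewrite ?addr0 ?add0r //=.
rewrite [X in _ + X](exchange_big_dep xpredT) //= -big_split big1 // => v _ /=.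
by rewrite -big_split big1 // => w /= /tC ->; rewrite addrN.
Qed.

(** The join of the chain [f] with the apex [a]. Values of [f] on sets that contain [a] are
    ignored. *)
Definition cone (a : V) f F : R :=
  if a \in F then face_sign F a * f (F :\ a) else 0.

(* The cone is a contracting homotopy, so it fills every cycle. *)
Lemma cone_boundary a f F : (a \in F -> chain_boundary f (F :\ a) = 0) ->
  chain_boundary (cone a f) F = f F.
Proof.
move=> cyc; rewrite chain_boundaryE /cone.
case: (boolP (a \in F)) => aF.
  (* The cycle condition at [F :\ a] expresses [f F] through the values of [f] at the other sets
     [v |: F :\ a]. *)
  move/(_ aF): cyc; rewrite chain_boundaryE.
  rewrite (bigD1 a) /=; last by rewrite !inE eqxx.
  rewrite setD1K // => /eqP; rewrite addr_eq0 => /eqP fF.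
  rewrite -[f F]mulr1 -(face_sign_sqr F a) mulrA fF mulNr mulr_suml -sumrN.
  apply: eq_big => [v|v]; rewrite !inE.
    by case: (eqVneq v a) => [->|]; rewrite ?aF ?andbT.
  move=> vF; have neq_va : v != a by apply: contraNneq vF => ->.
  rewrite aF orbT; have -> : (v |: F) :\ a = v |: F :\ a.
    by apply/setP => x; rewrite !inE; case: (eqVneq x v) => [->|]; rewrite ?neq_va.
  have := @face_sign_anticomm (v |: F) v a.
  rewrite !inE eqxx aF orbT => /(_ isT isT neq_va).
  have -> : (v |: F) :\ v = F by rewrite setU1K.
  have -> : (v |: F) :\ a = v |: F :\ a.
    by apply/setP => x; rewrite !inE; case: (eqVneq x v) => [->|]; rewrite ?neq_va.
  move: (face_sign_sqr (v |: F) v) (face_sign_sqr (v |: F :\ a) v).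
  move: (face_sign _ v) (face_sign _ a) (face_sign _ v) (face_sign _ a) (f _).
  move=> s t s' t' x ss ss' anti.
  (* All signs square to 1, so the anticommutation relation can be solved for one of them. *)
  have -> : t' = - (s' * (t * s)) by rewrite -[t']mul1r -ss -mulrA anti mulrN.
  by rewrite -[LHS]mulr1 -ss'; ring.
(* When [a] is not in [F], only [v = a] contributes, since the cone vanishes on sets without [a]. *)
rewrite (bigD1 a) /= ?inE //.
rewrite eqxx setU1K // mulrC mulrA face_sign_sqr mul1r big1 ?addr0 // => v.
by rewrite !inE => /andP[_ /negPf neq_va]; rewrite (negPf aF) eq_sym neq_va mul0r.
Qed.

End Incidence.

(** * Row vectors as functions supported on a set of faces *)

Section ChainRows.
Variables (T : finType) (A B : {set T}).

(** Extending by zero off [A] lets sums over the faces be traded for sums over all subsets. *)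
Lemma row_of_fun (R : nmodType) (u : 'rV[R]_#|A|) :
  exists f : T -> R, (forall x, x \notin A -> f x = 0) /\ u = \row_a f (enum_val a).
Proof.
exists (fun x => \sum_(a | enum_val a == x) u 0 a); split=> [x xA|].
  by rewrite big_pred0 // => a; apply: contraNF xA => /eqP <-; apply: enum_valP.
apply/rowP => a; rewrite mxE (bigD1 a) //= big1 ?addr0 // => b /andP[/eqP].
by move/enum_val_inj->; rewrite eqxx.
Qed.

Lemma mul_row_of_fun (R : pzRingType) (f : T -> R) (M : T -> T -> R) :
  (\row_(a < #|A|) f (enum_val a)) *m
    (\matrix_(a < #|A|, b < #|B|) M (enum_val a) (enum_val b)) =
  \row_b \sum_(x in A) f x * M x (enum_val b).
Proof.
apply/rowP => b; rewrite !mxE (big_enum_val (fun x => f x * M x _)).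
by apply: eq_bigr => a _; rewrite !mxE.
Qed.

Lemma row_of_fun_inj (R : Type) (f g : T -> R) :
  \row_(a < #|A|) f (enum_val a) = \row_(a < #|A|) g (enum_val a) <->
  {in A, f =1 g}.
Proof.
split=> [/rowP fg x xA | fg]; last by apply/rowP => a; rewrite !mxE fg ?enum_valP.
by have := fg (enum_rank_in xA x); rewrite !mxE enum_rankK_in.
Qed.

End ChainRows.

(** This is the second clause of [acyclic], carried from matrices to chains viewed as functions. *)
Lemma acyclic_fill (V : finType) (k : fieldType) (D : {set {set V}}) i
    (z : {set V} -> k) : acyclic k D ->
  (forall F, F \notin faces D i.+1 -> z F = 0) ->
  {in faces D i, chain_boundary z =1 fun=> 0} ->
  exists w : {set V} -> k, (forall H, H \notin faces D i.+2 -> w H = 0) /\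
    {in faces D i.+1, chain_boundary w =1 z}.
Proof.
have mulE j (f : {set V} -> k) : (forall F, F \notin faces D j.+1 -> f F = 0) ->
    (\row_a f (enum_val a)) *m boundary_mx k D j = \row_b chain_boundary f (enum_val b).
  move=> f0; rewrite mul_row_of_fun; apply/rowP => b; rewrite !mxE big_mkcond.
  by apply: eq_bigr => F _; case: ifPn => // /f0->; rewrite mul0r.
case=> _ /(_ i) ex z0 cyc.
have /sub_kermxP zK : (\row_a z (enum_val a)) *m boundary_mx k D i = 0.
  by rewrite mulE //; apply/rowP => b; rewrite !mxE cyc ?enum_valP.
have /submxP[w] := submx_trans zK ex; have [g [g0 ->]] := row_of_fun w.
rewrite mulE // => /row_of_fun_inj gz; exists g; split=> // F FD.
by rewrite gz.
Qed.

(** * Labels as least common multiples *)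

Section Label.
Variables (n : nat) (V : finType) (m : V -> 'X_{1..n}).
Local Notation lab := (label m).
Implicit Types F G : {set V}.

Lemma label_le F b : (label m F <= b)%MM = [forall v in F, (m v <= b)%MM].
Proof.
rewrite /label -big_andE; elim/big_ind2: _ => [|? ? ? ? <- <-|//].
  by apply/mnm_lepP => i; rewrite mnm0E.
by rewrite lem_mlcm.
Qed.

Lemma label_subset F G : F \subset G -> (label m F <= label m G)%MM.
Proof.
move=> sFG; rewrite label_le; apply/forall_inP => v vF.
have := lepm_refl (label m G); rewrite label_le => /forall_inP; apply.
exact: subsetP vF.
Qed.

Lemma label0 : label m set0 = 0%MM.
Proof. by rewrite /label big_set0. Qed.

Lemma eq_of_lepm (x y : 'X_{1..n}) :
  (forall b, (x <= b)%MM = (y <= b)%MM) -> x = y.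
Proof.
move=> eqxy; apply/mnmP => i; apply/eqP; rewrite eqn_leq.
have /mnm_lepP -> : (x <= y)%MM by rewrite eqxy lepm_refl.
by have /mnm_lepP -> : (y <= x)%MM by rewrite -eqxy lepm_refl.
Qed.

Lemma label1 v : lab [set v] = m v.
Proof.
apply: eq_of_lepm => b; rewrite label_le.
by apply/forall_inP/idP => [-> //|mb w /set1P->]; rewrite ?inE.
Qed.

End Label.

(** * Closure properties of generated ideals *)

Section Ideal.
Variables (R : comNzRingType) (J : finType) (A : {set J}) (g : J -> R).

Lemma ideal_gen_sum (T : finType) (P : pred T) (p : T -> R) :
  (forall t, P t -> ideal_gen A g (p t)) -> ideal_gen A g (\sum_(t | P t) p t).
Proof.
elim/big_ind: _ => //.
- by move=> _; exists (fun=> 0); rewrite big1 // => j _; rewrite mul0r.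
- move=> x y IHx IHy Pp; have [[c ->] [d ->]] := (IHx Pp, IHy Pp).
  by exists (fun j => c j + d j); rewrite -big_split; apply: eq_bigr => j _; rewrite mulrDl.
- by move=> t Pt; apply.
Qed.

Lemma ideal_gen_mul x p : ideal_gen A g p -> ideal_gen A g (x * p).
Proof.
by case=> c ->; exists (fun j => x * c j); rewrite mulr_sumr; apply: eq_bigr => j _; rewrite mulrA.
Qed.

Lemma ideal_gen_mem j : j \in A -> ideal_gen A g (g j).
Proof.
move=> jA; exists (fun i => (i == j)%:R); rewrite (bigD1 j) //= eqxx mul1r big1 ?addr0 // => i.
by case/andP=> _ /negPf->; rewrite mul0r.
Qed.

End Ideal.

(** * The homogenized complex and its multigraded strands *)

Section Homogenized.
Variables (k : fieldType) (n : nat) (V : finType) (m : V -> 'X_{1..n}).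
Variable D : {set {set V}}.
Hypothesis Dsc : simplicial_complex D.
Local Notation S := {mpoly k[n]}.
Local Notation lab := (label m).
Local Notation C := (homogenized_complex k m D).
Implicit Types F G H : {set V}.

(* The faces of cardinality [i] of the subcomplex usually written D_{<= b}. *)
Definition strand i (b : 'X_{1..n}) := [set F in faces D i | (lab F <= b)%MM].

(** Vanishing of the reduced homology of D_{<= b} in dimension [i]. Asking for the equations on all
    faces of [D] is no stronger: labels grow with the face, so both sides vanish at faces outside
    the strand. *)
Definition strand_exact i b := forall z : {set V} -> k,
  (forall F, F \notin strand i.+1 b -> z F = 0) ->
  {in faces D i, chain_boundary z =1 fun=> 0} ->
  exists w : {set V} -> k, (forall H, H \notin strand i.+2 b -> w H = 0) /\
    {in faces D i.+1, chain_boundary w =1 z}.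

Let dif F G : S := incidence k F G *: 'X_[(lab F - lab G)%MM].

Lemma faces0 : faces D 0 = [set set0].
Proof.
case: Dsc => D0 _ _; apply/setP => F; rewrite !inE cards_eq0.
by case: eqP => [->|]; rewrite ?D0 ?andbF.
Qed.

Lemma enum_val_faces0 (b : 'I_#|faces D 0|) : enum_val b = set0.
Proof.
have: enum_val b \in faces D 0 by apply: enum_valP.
by rewrite {2}faces0 inE => /eqP.
Qed.

Lemma mem_faces_sub F G : F \in D -> G \subset F -> G \in faces D #|G|.
Proof. by case: Dsc => _ _ sub FD sGF; rewrite inE eqxx andbT (sub F). Qed.

Lemma face_incidence i F G : F \in faces D i.+1 -> incidence k F G != 0 -> G \in faces D i.
Proof.
rewrite inE => /andP[FD /eqP cF] inc.
have := mem_faces_sub FD (incidence_neq0_sub inc).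
by have := incidence_neq0_card inc; rewrite cF => -[<-].
Qed.

Lemma mnm_sub_trans (a b c : 'X_{1..n}) : (b <= a)%MM -> (c <= b)%MM ->
  (a - b + (b - c) = a - c)%MM.
Proof.
move=> /mnm_lepP ba /mnm_lepP cb; apply/mnmP => i; rewrite !mnmE.
by move: (ba i) (cb i); lia.
Qed.

(** In multidegree [b] the basis element of [F] appears multiplied by x^(b - lab F). On such
    elements the differential acts by the scalar incidence numbers. *)
Lemma dif_mul F G H (b : 'X_{1..n}) : (lab F <= b)%MM ->
  'X_[(b - lab F)%MM] * dif F G = incidence k F G *: 'X_[(b - lab G)%MM] :> S.
Proof.
move=> Fb; rewrite /dif -scalerAr; have [-> | inc] := eqVneq (incidence k F G) 0.
  by rewrite !scale0r.
by rewrite -mpolyXD mnm_sub_trans // label_subset // (incidence_neq0_sub inc).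
Qed.

Lemma mcoeff_dif (p : S) F G b : (lab G <= b)%MM ->
  (p * dif F G)@_(b - lab G) =
  (if (lab F <= b)%MM then p@_(b - lab F) else 0) * incidence k F G.
Proof.
move=> Gb; rewrite /dif -scalerAr mcoeffZ mulrC.
have [->|inc] := eqVneq (incidence k F G) 0; first by rewrite !mulr0.
have sGF := label_subset m (incidence_neq0_sub inc).
congr (_ * _); case: ifPn => [Fb|]; first by rewrite -(mnm_sub_trans Fb sGF) addmC mcoeffMX.
(* A monomial of degree [b - lab G] in the product has the form [(lab F - lab G) + c]. Adding
   [lab G] gives [b = lab F + c], so [lab F] would divide [b]. *)
apply: contraNeq; rewrite -mcoeff_msupp (perm_mem (msuppMX _ _)) => /mapP[c _].
by move/(congr1 (fun e => (e + lab G)%MM)); rewrite submK //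
  [((_ - _) + c)%MM]addmC -addmA submK // => ->; rewrite lem_addl.
Qed.

Lemma homogenized_comp i : fc_dif C i.+1 *m fc_dif C i = 0.
Proof.
apply/matrixP => a b; rewrite !mxE; under eq_bigr => c _ do rewrite !mxE.
rewrite -(big_enum_val (fun G => dif (enum_val a) G * dif G (enum_val b))).
have := enum_valP a; move: (enum_val a) (enum_val b) => F H FD.
transitivity (\sum_G (incidence k F G * incidence k G H) *: ('X_[(lab F - lab H)%MM] : S)).
  rewrite big_mkcond; apply: eq_bigr => G _; rewrite -scalerA.
  have [inc|inc] := eqVneq (incidence k F G) 0.
    by rewrite /dif inc !scale0r mul0r if_same.
  (* [dif_mul] is used with [b := lab F], for which its monomial is the one in [dif F G]. *)
  rewrite (face_incidence FD inc) {1}/dif -scalerAl dif_mul //.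
  by rewrite label_subset // (incidence_neq0_sub inc).
by rewrite -scaler_suml incidence_comp scale0r.
Qed.

Lemma homogenized_multigraded : multigraded C.
Proof.
split=> [i a b e|b e] /=.
  rewrite mxE; move: (enum_val a) (enum_val b) => F G eFG.
  have inc : incidence k F G != 0.
    by apply: contraTneq eFG => inc0; rewrite inc0 scale0r msupp0.
  move: eFG; rewrite mcoeff_msupp mcoeffZ mcoeffX mulf_eq0 negb_or => /andP[_].
  case: (_ =P e) => [<- _|]; last by rewrite eqxx.
  by rewrite submK // label_subset // (incidence_neq0_sub inc).
by rewrite enum_val_faces0 mxE msupp1 inE label0 => /eqP.
Qed.

Lemma mul_row_dif i (f : {set V} -> S) :
  (\row_(a < #|faces D i.+1|) f (enum_val a)) *m fc_dif C i =
  \row_b \sum_(F in faces D i.+1) f F * dif F (enum_val b).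
Proof. exact: mul_row_of_fun. Qed.

(** A Scarf face shares its label with no facet of its own, so every nonzero matrix entry is
    divisible by some variable. *)
Lemma homogenized_minimal : D \subset scarf_complex m -> minimal_complex C.
Proof.
move=> sDm i u b; have [f [_ ->]] := row_of_fun u.
rewrite mul_row_dif mxE; apply: ideal_gen_sum => F FD; apply: ideal_gen_mul.
move: (enum_val b) => G; have [inc0|inc] := eqVneq (incidence k F G) 0.
  rewrite /dif inc0 scale0r -(mul0r 0); apply: ideal_gen_mul; exists (fun=> 0).
  by rewrite big1 // => j _; rewrite mul0r.
have neq : lab F != lab G.
  move: FD; rewrite inE => /andP[/(subsetP sDm)]; rewrite inE => /forallP/(_ G)/implyP eqGF _.
  rewrite eq_sym; apply/negP => /eqGF/eqP GF.
  by have := incidence_neq0_card inc; rewrite GF; apply: n_Sn.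
have [j jFG] : exists j, ((lab F - lab G)%MM j != 0)%N.
  apply/existsP; rewrite -negb_forall; apply: contraNN neq => /forallP eq0.
  apply/eqP; rewrite -(submK (label_subset m (incidence_neq0_sub inc))).
  suff -> : (lab F - lab G = 0)%MM by rewrite add0m.
  by apply/mnmP => j; rewrite mnm0E; apply/eqP.
have Uj : (U_(j) <= lab F - lab G)%MM by rewrite lep1mP.
rewrite /dif -(submK Uj) mpolyXD scalerAl.
by apply: ideal_gen_mul; apply: (ideal_gen_mem (fun i : 'I_n => 'X_i : S)).
Qed.

Lemma homogenized_aug u : exists2 p : S, u = \row_(a < #|faces D 0|) p & (u *m fc_aug C) 0 0 = p.
Proof.
have [f [_ ->]] := row_of_fun u; exists (f set0).
  by apply/rowP => a; rewrite !mxE enum_val_faces0.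
rewrite mxE; under eq_bigr => a _ do rewrite !mxE mulr1.
by rewrite -(big_enum_val f) faces0 big_set1.
Qed.

Lemma sum_faces1 (h : {set V} -> S) : \sum_(F in faces D 1) h F = \sum_v h [set v].
Proof.
have -> : faces D 1 = [set [set v] | v in [set: V]].
  case: Dsc => _ D1 _; apply/setP => F; rewrite inE.
  apply/andP/imsetP => [[_ /cards1P[v ->]]|[v _ ->]]; first by exists v.
  by rewrite D1 cards1.
by rewrite big_imset /= => [|v w _ _ /set1_inj //]; apply: eq_bigl => v; rewrite inE.
Qed.

(** With [homogenized_aug], this identifies the image of the first differential with the ideal
    generated by [m]. *)
Lemma homogenized_dif0 (f : {set V} -> S) :
  (\row_(a < #|faces D 1|) f (enum_val a)) *m fc_dif C 0 =
  \row_b \sum_v f [set v] * 'X_[m v].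
Proof.
rewrite mul_row_dif; apply/rowP => b; rewrite !mxE sum_faces1.
rewrite enum_val_faces0.
apply: eq_bigr => v _; rewrite /dif label1 label0; congr (_ * _).
rewrite /incidence (big_pred1 v) => [|w]; last first.
  rewrite !inE; case: eqVneq => //= ->.
  by apply/eqP/setP => x; rewrite !inE andNb.
rewrite (_ : [set _ in _ | _] = set0) ?cards0 ?expr0 ?scale1r; last first.
  by apply/setP => w; rewrite !inE; case: eqVneq => //= ->; rewrite ltnn.
by congr 'X_[_]; apply/mnmP => i; rewrite mnmBE mnm0E subn0.
Qed.

(** A cycle is the finite sum of its multigraded pieces. Each piece is a scalar cycle of one strand,
    which is filled there and homogenized again. *)
Lemma homogenized_exact i (u : 'rV_(fc_rank C i.+1)) :
  (forall b, strand_exact i b) -> u *m fc_dif C i = 0 ->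
  exists w : 'rV_(fc_rank C i.+2), u = w *m fc_dif C i.+1.
Proof.
move=> ex; have [f [f0 ->]] := row_of_fun u.
rewrite mul_row_dif => /rowP uD0.
have cyc G : G \in faces D i -> \sum_(F in faces D i.+1) f F * dif F G = 0.
  by move=> GD; have := uD0 (enum_rank_in GD G); rewrite !mxE enum_rankK_in.
(* [z b] is the piece of multidegree [b], as a scalar chain. The guard matters: if [lab F] does not
   divide [b], the truncated subtraction would pick an unrelated coefficient. *)
pose z b F : k := if F \in strand i.+1 b then (f F)@_(b - lab F) else 0.
(* The multidegrees occurring in the cycle, each listed once so that no piece is counted twice. *)
pose s := undup (flatten [seq [seq (c + lab F)%MM | c <- msupp (f F)] | F <- enum {set V}]).
have fE F : F \in faces D i.+1 -> f F = \sum_(b <- s) z b F *: 'X_[(b - lab F)%MM].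
  move=> FD; apply/mpolyP => c; rewrite raddf_sum /=.
  transitivity (\sum_(b <- s) if b == (c + lab F)%MM then (f F)@_c else 0).
    have [cs|cs] := boolP ((c + lab F)%MM \in s).
      by rewrite (bigD1_seq _ cs) ?undup_uniq //= eqxx big1 ?addr0 // => b /negPf->.
    rewrite big1_seq => [|b /andP[_ bs]]; last first.
      by case: eqP => // bE; rewrite -bE bs in cs.
    apply/eqP; rewrite mcoeff_eq0; apply: contraNN cs => cf; rewrite mem_undup.
    by apply/flatten_mapP; exists F; rewrite ?mem_enum //; apply: map_f cf.
  apply: eq_bigr => b _; rewrite mcoeffZ mcoeffX /z inE FD /=.
  have [-> | neq] := eqVneq b (c + lab F)%MM.
    by rewrite lem_addl addmK eqxx mulr1.
  case: ifPn => [Fb|_]; last by rewrite mul0r.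
  case: (_ =P c) => [cE|_]; last by rewrite mulr0.
  by case/eqP: neq; rewrite -cE submK.
have zcyc b : {in faces D i, chain_boundary (z b) =1 fun=> 0}.
  (* If [lab G] does not divide [b], neither does the label of any [F] containing [G], so each term
     is zero. Otherwise the value is a coefficient of the equation [cyc]. *)
  move=> G GD; have [Gb | nGb] := boolP (lab G <= b)%MM; last first.
    rewrite /chain_boundary big1 // => F _; rewrite /z inE.
    have [->|inc] := eqVneq (incidence k F G) 0; first by rewrite mulr0.
    case: ifPn => [/andP[_ Fb]|_]; last by rewrite mul0r.
    by case/negP: nGb; apply: lepm_trans Fb; rewrite label_subset // (incidence_neq0_sub inc).
  rewrite -(mcoeff0 _ (b - lab G)%MM) -(cyc G GD) raddf_sum /=.
  rewrite /chain_boundary [RHS]big_mkcond; apply: eq_bigr => F _.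
  rewrite mcoeff_dif // /z [F \in strand _ _]inE.
  by case: (F \in faces D _); rewrite /= ?mul0r.
have -> : \row_a f (enum_val a) =
    \sum_(b <- s) \row_(a < #|faces D i.+1|)
      (z b (enum_val a) *: 'X_[(b - lab (enum_val a))%MM] : S).
  apply/rowP => a; rewrite summxE mxE fE ?enum_valP //.
  by apply: eq_bigr => b _; rewrite mxE.
elim/big_ind: _ => [|_ _ [w1 ->] [w2 ->]|b _].
- by exists 0; rewrite mul0mx.
- by exists (w1 + w2); rewrite mulmxDl.
have [w [w0 wz]] := ex b (z b) (fun F nF => ltac:(by rewrite /z (negPf nF))) (zcyc b).
(* The scalar filling [w], homogenized back to multidegree [b]. *)
pose g H : S := w H *: 'X_[(b - lab H)%MM].
exists (\row_c g (enum_val c)); rewrite (mul_row_dif _ g); apply/rowP => a; rewrite !mxE.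
rewrite -wz ?enum_valP // /chain_boundary scaler_suml [RHS]big_mkcond.
apply: eq_bigr => H _; rewrite /g.
case: ifPn => [HD|nH].
  have [Hb|nHb] := boolP (lab H <= b)%MM; last first.
    by rewrite w0 ?mul0r ?scale0r ?mul0r // inE negb_and nHb orbT.
  by rewrite -scalerAl dif_mul // scalerA.
by rewrite w0 ?mul0r ?scale0r // inE negb_and nH.
Qed.

End Homogenized.

(** * From exact strands to a minimal free resolution *)

Section Criterion.
Variables (k : fieldType) (n : nat) (V : finType) (m : V -> 'X_{1..n}).
Variable D : {set {set V}}.
Hypothesis Dsc : simplicial_complex D.
Local Notation S := {mpoly k[n]}.
Local Notation C := (homogenized_complex k m D).

(** The strands give exactness in positive homological degrees. At [F_0], the image of the first
    differential is computed directly. *)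
Lemma homogenized_resolution :
  D \subset scarf_complex m -> (forall i b, strand_exact k m D i b) ->
  supports_minimal_resolution m D (monomial_ideal_gen (k := k) [set: V] m).
Proof.
move=> sDm ex; split; [exact: homogenized_multigraded | | exact: homogenized_minimal].
split=> [p|u|i u].
- have card0 : #|faces D 0| = 1%N by rewrite faces0 // cards1.
  exists (const_mx p).
  rewrite mxE; under eq_bigr => a _ do rewrite !mxE mulr1.
  rewrite sumr_const (etrans (card_ord _) card0) subrr.
  by exists (fun=> 0); rewrite big1 // => v _; rewrite mul0r.
- have [p -> ->] := homogenized_aug m Dsc u; split=> [[c ->]|[w]].
    (* Any extension of [c] from vertices to sets would do; on a singleton this sum returns
       [c v]. *)
    pose g (F : {set V}) : S := \sum_(v in F) c v.
    exists (\row_(a < #|faces D 1|) g (enum_val a)).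
    rewrite (homogenized_dif0 _ _ g) //; apply/rowP => b; rewrite !mxE.
    by apply: eq_big => [v|v _]; rewrite /g ?inE ?big_set1.
  have [f [_ ->]] := row_of_fun w; rewrite homogenized_dif0 //.
  have a0 : set0 \in faces D 0 by rewrite faces0 // inE.
  move/rowP/(_ (enum_rank_in a0 set0)); rewrite !mxE => ->.
  by exists (fun v => f [set v]); apply: eq_bigl => v; rewrite inE.
- split=> [|[w ->]]; first exact: homogenized_exact.
  by rewrite -mulmxA homogenized_comp // mulmx0.
Qed.

End Criterion.

(** The coefficient of ['X_[e]] is 1, so some multiple of a generator must contain that monomial. *)
Lemma monomial_mem_ideal (k : fieldType) (n : nat) (J : finType) (A : {set J})
    (m : J -> 'X_{1..n}) e :
  monomial_ideal_gen A m ('X_[e] : {mpoly k[n]}) ->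
  exists2 j, j \in A & (m j <= e)%MM.
Proof.
case=> c /(congr1 (mcoeff e)); rewrite mcoeffX eqxx raddf_sum /= => eq1.
suff /exists_inP[j jA je] : [exists j in A, (m j <= e)%MM] by exists j.
apply: contraT => /exists_inPn no; have /eqP[] := oner_neq0 k.
rewrite -[LHS]/(true%:R) eq1 big1 // => j jA.
apply/eqP; rewrite mcoeff_eq0 (perm_mem (msuppMX _ _)).
by apply: contra (no j jA) => /mapP[d _ ->]; rewrite lem_addr.
Qed.

(** * The monomials avoiding faces, their Scarf complex and their strands *)

Section AvoidingFaces.
Variables (V : finType) (D : {set {set V}}).
Hypothesis Dsc : simplicial_complex D.
Implicit Types F G H : {set V}.

Definition avoiding_monomial (v : V) : 'X_{1..#|D|} :=
  [multinom nat_of_bool (v \notin enum_val i) | i < #|D|].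
Local Notation m := avoiding_monomial.

(** The labels are squarefree, so only the variables absent from [b] impose a condition. *)
Lemma avoiding_label_le G b :
  (label m G <= b)%MM = [forall i, (b i == 0%N) ==> (G \subset enum_val i)].
Proof.
rewrite label_le; apply/forall_inP/forallP => [le_b i|sub v vG].
  apply/implyP => /eqP bi; apply/subsetP => v /le_b /mnm_lepP/(_ i).
  by rewrite mnmE bi leqn0 eqb0 negbK.
apply/mnm_lepP => i; rewrite mnmE; case: (posnP (b i)) => [bi|]; last exact: leq_trans (leq_b1 _).
by have := sub i; rewrite bi => /subsetP/(_ v vG)->.
Qed.

Lemma avoiding_label_face G H :
  G \in D -> (label m H <= label m G)%MM -> H \subset G.
Proof.
move=> GD le_HG; pose i := enum_rank_in GD G.
(* The bound is the product of all variables except x_G. Dividing it means exactly being contained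
   in [G]. *)
have le_b : (label m G <= [multinom nat_of_bool (j != i) | j < #|D|])%MM.
  rewrite avoiding_label_le; apply/forallP => j; rewrite mnmE eqb0 negbK.
  by apply/implyP => /eqP->; rewrite enum_rankK_in.
have := lepm_trans le_HG le_b; rewrite avoiding_label_le => /forallP/(_ i).
by rewrite mnmE eqxx enum_rankK_in.
Qed.

Lemma avoiding_label_nonface G H :
  G \notin D -> H \notin D -> label m G = label m H.
Proof.
have out K (i : 'I_#|D|) : K \notin D -> (K \subset enum_val i) = false.
  by case: Dsc => _ _ sub; apply: contraNF; apply: sub (enum_valP i).
move=> nG nH; apply: eq_of_lepm => b; rewrite !avoiding_label_le.
by apply: eq_forallb => i; rewrite !out.
Qed.

Lemma avoiding_scarf : ~ is_simplex_boundary D -> scarf_complex m = D.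
Proof.
move=> notbd; have [D0 _ sub] := Dsc; apply/setP => G; rewrite inE.
apply/forallP/idP => [uniqG|GD H]; last first.
  apply/implyP => /eqP eqHG.
  have sHG : H \subset G by apply: avoiding_label_face; rewrite ?eqHG ?lepm_refl.
  have sGH : G \subset H.
    by apply: avoiding_label_face; [exact: sub sHG | rewrite eqHG lepm_refl].
  by rewrite eqEsubset sHG.
apply: contraT => nG.
(* All non-faces share one label, so a non-face [G] with unique label is the only one. It must then
   be the whole vertex set, which makes [D] a simplex boundary. *)
have nonface H : H \notin D -> H = G.
  by move=> nH; apply/eqP/(implyP (uniqG H))/eqP/avoiding_label_nonface.
have nT : [set: V] \notin D by apply: contra nG => TD; apply: sub TD (subsetT G).
case: notbd; exists [set: V]; apply/setP => F; rewrite inE properT.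
apply/idP/idP => [FD|]; first by apply: contraTneq FD => ->.
by apply: contraNT => nF; rewrite (nonface F) // (nonface [set: V]).
Qed.

Lemma avoiding_minimal_generators (k : fieldType) :
  minimal_monomial_generators (monomial_ideal_gen (k := k) [set: V] m) m.
Proof.
case: Dsc => _ D1 sub A; split=> [eqA|->]; last by [].
apply/setP => v; rewrite inE.
have /eqA/monomial_mem_ideal[w wA] : monomial_ideal_gen [set: V] m ('X_[m v] : {mpoly k[#|D|]}).
  by apply: (ideal_gen_mem (fun v => 'X_[m v])); rewrite inE.
have [<- //|neq_wv] := eqVneq w v.
rewrite -!(label1 m) => /(avoiding_label_face (D1 v)).
by rewrite sub1set inE (negPf neq_wv).
Qed.

Lemma avoiding_squarefree (k : fieldType) :
  squarefree_monomial_ideal (monomial_ideal_gen (k := k) [set: V] m).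
Proof.
exists #|V|, (fun j => m (enum_val j)); split=> [j i|p]; first by rewrite mnmE leq_b1.
split=> [] [c ->].
  exists (fun j => c (enum_val j)); rewrite (reindex _ (onW_bij _ (@enum_val_bij V))) /=.
  by apply: eq_bigl => j; rewrite !inE.
exists (fun v => c (enum_rank v)); rewrite (reindex _ (onW_bij _ (@enum_rank_bij V))) /=.
by apply: eq_big => [v|v _]; rewrite ?inE ?enum_rankK.
Qed.

Lemma avoiding_strand_exact (k : fieldType) i b :
  acyclic k D -> strand_exact k m D i b.
Proof.
case: (Dsc) => _ _ sub acD z z0 cyc.
have [bpos | /forallPn[j0 /negPn bj0]] := boolP [forall j, b j != 0%N].
  have strandE j : strand m D j b = faces D j.
    apply/setP => F; rewrite inE avoiding_label_le andb_idr // => _.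
    by apply/forallP => l; rewrite (negPf (forallP bpos l)).
  by rewrite strandE in z0; rewrite strandE; apply: acyclic_fill acD z0 cyc.
(* [j0] guarantees that at least one face is intersected, so [W] is itself a face and the strand is
   the full simplex on it. *)
pose W := \bigcap_(j | b j == 0%N) enum_val j.
have leW G : (label m G <= b)%MM = (G \subset W).
  by rewrite avoiding_label_le; apply/forall_inP/bigcapsP.
have WD : W \in D.
  by apply: (sub (enum_val j0)) (enum_valP j0) _; apply: bigcap_inf.
(* If [W] is empty, only the empty face is left. It has cardinality 0, so [z], living in cardinality
   [i.+1], is zero. *)
have [W0|[a aW]] := set_0Vmem W.
  exists (fun=> 0); split=> // F FD; rewrite z0 /chain_boundary.
    by rewrite big1 // => H _; rewrite mul0r.
  rewrite inE leW W0 subset0 FD /=; apply: contraTneq FD => ->.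
  by rewrite inE cards0 andbF.
exists (cone a z); split=> [H nH|F]; last first.
  rewrite inE => /andP[FD /eqP cF]; apply: cone_boundary => aF; apply: cyc.
  rewrite inE (sub F) ?subsetDl //=.
  by move: cF; rewrite (cardsD1 a) aF => -[<-].
(* The cone stays in the strand: since [a] lies in [W], adding it to a subset of [W] gives a subset
   of [W]. *)
rewrite /cone; case: ifP => // aH; rewrite z0 ?mulr0 //.
apply: contra nH; rewrite !inE !leW => /andP[/andP[_ /eqP cH] sHW].
have {}sHW : H \subset W by rewrite -(setD1K aH) subUset sub1set aW.
by rewrite (sub W) // sHW (cardsD1 a) aH cH !eqxx.
Qed.

End AvoidingFaces.

Theorem proposition2p6 (k : fieldType) (V : finType) (D : {set {set V}})
    (hD : simplicial_complex D) (hbd : ~ is_simplex_boundary D) :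
  exists (n : nat) (I : {mpoly k[n]} -> Prop) (m : V -> 'X_{1..n}),
    [/\ squarefree_monomial_ideal I,
        minimal_monomial_generators I m,
        scarf_complex m = D
      & acyclic k D -> supports_minimal_resolution m D I].
Proof.
exists #|D|, (monomial_ideal_gen [set: V] (avoiding_monomial D)), (avoiding_monomial D).
split; [exact: avoiding_squarefree | exact: avoiding_minimal_generators | exact: avoiding_scarf |].
move=> acD; apply: homogenized_resolution => [//||i b].
  by rewrite avoiding_scarf.
exact: avoiding_strand_exact.
Qed.
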